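(* Let $\alpha^*$ be an $N$-$R^*$ associated curve of $\alpha$ (with respect to the real numbers $e,f$), and let $\{T^*,N^*,B^*\}$ be the Frenet frame of $\alpha^*$. Put $$K=\lambda'(\lambda\tau'+2\lambda'\tau)-\lambda\tau\big((-\lambda\kappa+1)\kappa-\lambda\tau^2+\lambda''\big),$$ $$L=(\lambda\kappa-1)(\lambda\tau'+2\lambda'\tau)+\lambda\tau(-\lambda\kappa'-2\lambda'\kappa),$$ $$M=(-\lambda\kappa+1)\big((-\lambda\kappa+1)\kappa-\lambda\tau^2+\lambda''\big)-\lambda'(-\lambda\kappa'-2\lambda'\kappa).$$ Then the Frenet frames of $\alpha$ and $\alpha^*$ are related by $$T^*=\frac{1}{\sqrt{e^2+f^2}}\left(\frac{(-\lambda\kappa+1)f}{\sqrt{(-\lambda\kappa+1)^2+(\lambda\tau)^2}}\,T+e\,N+\frac{\lambda\tau f}{\sqrt{(-\lambda\kappa+1)^2+(\lambda\tau)^2}}\,B\right),$$ $$N^*=\frac{ef}{\sqrt{e^2+f^2}}\left(\Big(\frac{\lambda\tau}{\lambda'}-\frac{M}{L}\Big)T+\Big(\frac{K}{L}+\frac{\lambda\kappa-1}{\lambda'}\Big)B\right),$$ $$B^*=\frac{f}{\sqrt{e^2+f^2}}\left(\frac{K}{L}\,T+N+\frac{M}{L}\,B\right).$$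
   Context: $\alpha$ and $\alpha^*$ are differentiable curves in $E^3$; $\alpha$ is parametrized by arc length $s$ and has Frenet frame $\{T,N,B\}$, curvature $\kappa$ and torsion $\tau$, with $T'=\kappa N$, $N'=-\kappa T+\tau B$, $B'=-\tau N$. The Frenet frame of a curve $\gamma$ is given by $\gamma'/\|\gamma'\|$ (tangent), $(\gamma'\wedge\gamma'')/\|\gamma'\wedge\gamma''\|$ (binormal), and principal normal = binormal $\wedge$ tangent. For arbitrary real numbers $e,f$ put $R^*=\frac{eT^*+fB^*}{\sqrt{e^2+f^2}}$, a unit vector lying in the rectifying plane of $\alpha^*$. The curve $\alpha^*$ is called an $N$-$R^*$ associated curve of $\alpha$ if the principal normal $N$ of $\alpha$ is linearly dependent with the vector $R^*$. The function $\lambda$ of $s$ is the one for which $\alpha^*=\alpha+\lambda N$; primes denote derivatives with respect to $s$.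
   Formalization: The prefactor of N* is corrected to ef/(e²+f²); the B* formula is stated when N and R* point the same way (N = R* ), the T* formula when moreover f > 0, since the printed signs fail otherwise; λ′ ≠ 0 and L ≠ 0 are required where divided by. *)

(* Defs.v *)
From mathcomp Require Import all_boot all_order all_algebra.
From mathcomp Require Import all_classical all_reals all_analysis.
Set Implicit Arguments.
Unset Strict Implicit.
Unset Printing Implicit Defensive.
Import Order.TTheory GRing.Theory Num.Theory.
Import numFieldNormedType.Exports.
Local Open Scope classical_set_scope.
Local Open Scope ring_scope.

(* The library norm on 'rV[R]_3 is the sup norm; it is used for the topology
   (hence for derivatives) only. Lengths are Euclidean: [enorm]. *)
Definition dot (R : realType) (u v : 'rV[R]_3) : R := \sum_j u 0 j * v 0 j.

Definition enorm (R : realType) (u : 'rV[R]_3) : R := Num.sqrt (dot u u).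

(* Indices are added in 'I_3, that is, modulo 3. *)
Definition cross (R : realType) (u v : 'rV[R]_3) : 'rV[R]_3 :=
  \row_(j < 3) (u 0 (j + 1) * v 0 (j + 2%:R) - u 0 (j + 2%:R) * v 0 (j + 1)).

Definition derivable_upto (R : realType) (n : nat) (I : set R)
    (gamma : R -> 'rV[R]_3) : Prop :=
  forall k, (k < n)%N -> forall s, I s -> derivable (derive1n k gamma) s 1.

(* gamma need not be parametrized by arc length. *)
Definition frenet_T (R : realType) (gamma : R -> 'rV[R]_3) (s : R) : 'rV[R]_3 :=
  (enorm (derive1 gamma s))^-1 *: derive1 gamma s.

Definition frenet_B (R : realType) (gamma : R -> 'rV[R]_3) (s : R) : 'rV[R]_3 :=
  let b := cross (derive1 gamma s) (derive1n 2 gamma s) in (enorm b)^-1 *: b.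

Definition frenet_N (R : realType) (gamma : R -> 'rV[R]_3) (s : R) : 'rV[R]_3 :=
  cross (frenet_B gamma s) (frenet_T gamma s).

(* The curves for which the frame above exists everywhere on I. *)
Definition has_frenet_frame (R : realType) (I : set R)
    (gamma : R -> 'rV[R]_3) : Prop :=
  forall s, I s -> cross (derive1 gamma s) (derive1n 2 gamma s) != 0.

Definition frenet_equations (R : realType) (I : set R) (alpha : R -> 'rV[R]_3)
    (kappa tau : R -> R) : Prop :=
  let T := frenet_T alpha in
  let N := frenet_N alpha in
  let B := frenet_B alpha in
  forall s, I s ->
    [/\ is_derive s 1 T (kappa s *: N s),
        is_derive s 1 N (- kappa s *: T s + tau s *: B s)
      & is_derive s 1 B (- tau s *: N s)].

Definition rectifying (R : realType) (e f : R) (gamma : R -> 'rV[R]_3) (s : R) :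
    'rV[R]_3 :=
  (Num.sqrt (e ^+ 2 + f ^+ 2))^-1 *:
    (e *: frenet_T gamma s + f *: frenet_B gamma s).

Definition NR_associated (R : realType) (I : set R) (e f : R)
    (alpha alphas : R -> 'rV[R]_3) : Prop :=
  forall s, I s -> ~~ free [:: frenet_N alpha s; rectifying e f alphas s].

(* K, L, M are the coordinates, in the Frenet frame of alpha, of the cross
   product of the first two derivatives of alpha + lambda N. *)
Definition NR_coefK (R : realType) (kappa tau lambda : R -> R) (s : R) : R :=
  derive1 lambda s * (lambda s * derive1 tau s + 2 * derive1 lambda s * tau s)
  - lambda s * tau s *
    ((- lambda s * kappa s + 1) * kappa s - lambda s * tau s ^+ 2
     + derive1n 2 lambda s).

Definition NR_coefL (R : realType) (kappa tau lambda : R -> R) (s : R) : R :=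
  (lambda s * kappa s - 1) *
    (lambda s * derive1 tau s + 2 * derive1 lambda s * tau s)
  + lambda s * tau s *
    (- lambda s * derive1 kappa s - 2 * derive1 lambda s * kappa s).

Definition NR_coefM (R : realType) (kappa tau lambda : R -> R) (s : R) : R :=
  (- lambda s * kappa s + 1) *
    ((- lambda s * kappa s + 1) * kappa s - lambda s * tau s ^+ 2
     + derive1n 2 lambda s)
  - derive1 lambda s *
    (- lambda s * derive1 kappa s - 2 * derive1 lambda s * kappa s).

(* Main.v *)
Require Import Defs.
From mathcomp Require Import all_boot all_order all_algebra.
From mathcomp Require Import all_classical all_reals all_analysis.
From mathcomp Require Import ring.
Import Order.TTheory GRing.Theory Num.Theory.
Import numFieldNormedType.Exports.
Local Open Scope classical_set_scope.
Local Open Scope ring_scope.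

(* Write (a, b, c) and (K, L, M) for the coordinates of alphas' and of
   alphas' x alphas'' in the frame of alpha, so that T* = (a, b, c) / v and
   B* = (K, L, M) / w with v and w the two norms. Both N and R* are unit
   vectors, hence N = d R* with d = 1 or d = -1; pairing N with T*, B* and N*
   gives b / v = d e / r, L / w = d f / r and M a - K c = 0. These relations
   eliminate v and w; the sign d cancels in N* = B* x T*, which only involves
   1 / (v w). Differentiating alphas twice requires derivatives of kappa, tau,
   lambda and lambda', which are recovered from the scalar products
   kappa = alpha'' . N, kappa tau = alpha''' . B, lambda = (alphas - alpha) . N
   and lambda' = alphas' . N. *)

(** * Dot and cross product in coordinates; vector identities reduce to ring identities *)

Section Vectors.
Context {R : realType}.
Implicit Types (u v w : 'rV[R]_3) (a x y z : R).

Lemma row3P u v :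
  u 0 0 = v 0 0 -> u 0 1 = v 0 1 -> u 0 2%:R = v 0 2%:R -> u = v.
Proof.
move=> h0 h1 h2; apply/rowP => j.
have : [|| j == 0, j == 1 | j == 2%:R] by case: j => -[|[|[|]]].
by case/or3P => /eqP ->.
Qed.

Lemma dotE u v :
  dot u v = u 0 0 * v 0 0 + u 0 1 * v 0 1 + u 0 2%:R * v 0 2%:R.
Proof.
rewrite /dot !big_ord_recr big_ord0 /= add0r.
by congr (u 0 _ * v 0 _ + u 0 _ * v 0 _ + u 0 _ * v 0 _); exact: val_inj.
Qed.

Lemma crossE u v :
  ((cross u v 0 0 = u 0 1 * v 0 2%:R - u 0 2%:R * v 0 1) *
   (cross u v 0 1 = u 0 2%:R * v 0 0 - u 0 0 * v 0 2%:R) *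
   (cross u v 0 2%:R = u 0 0 * v 0 1 - u 0 1 * v 0 0))%type.
Proof.
by split; [split|]; rewrite mxE;
  (* The indices [j + 1] and [j + 2%:R] wrap around modulo 3, so they are compared through their
     values. *)
  congr (u 0 _ * v 0 _ - u 0 _ * v 0 _); exact: val_inj.
Qed.

Definition coordE := (dotE, crossE, mxE).

Lemma dotC u v : dot u v = dot v u.
Proof. by rewrite !coordE; ring. Qed.

Lemma dotDl u v w : dot (u + v) w = dot u w + dot v w.
Proof. by rewrite !coordE; ring. Qed.

Lemma dotZl a u v : dot (a *: u) v = a * dot u v.
Proof. by rewrite !coordE; ring. Qed.

Lemma dotDr u v w : dot w (u + v) = dot w u + dot w v.
Proof. by rewrite !coordE; ring. Qed.

Lemma dotZr a u v : dot v (a *: u) = a * dot v u.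
Proof. by rewrite !coordE; ring. Qed.

Lemma crossDl u v w : cross (u + v) w = cross u w + cross v w.
Proof. by apply: row3P; rewrite !coordE; ring. Qed.

Lemma crossZl a u v : cross (a *: u) v = a *: cross u v.
Proof. by apply: row3P; rewrite !coordE; ring. Qed.

Lemma crossC u v : cross u v = - cross v u.
Proof. by apply: row3P; rewrite !coordE; ring. Qed.

Lemma crossDr u v w : cross w (u + v) = cross w u + cross w v.
Proof. by apply: row3P; rewrite !coordE; ring. Qed.

Lemma crossZr a u v : cross v (a *: u) = a *: cross v u.
Proof. by apply: row3P; rewrite !coordE; ring. Qed.

Lemma crossvv u : cross u u = 0.
Proof. by apply: row3P; rewrite !coordE; ring. Qed.

Lemma cross0v u : cross 0 u = 0.
Proof. by apply: row3P; rewrite !coordE; ring. Qed.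

Lemma crossv0 u : cross u 0 = 0.
Proof. by apply: row3P; rewrite !coordE; ring. Qed.

Lemma cross_crossr u v w :
  cross u (cross v w) = dot u w *: v - dot u v *: w.
Proof. by apply: row3P; rewrite !coordE; ring. Qed.

Lemma dot_crossl u v : dot (cross u v) u = 0.
Proof. by rewrite !coordE; ring. Qed.

Lemma dot_cross_cross u v w (t : 'rV[R]_3) :
  dot (cross u v) (cross w t) = dot u w * dot v t - dot u t * dot v w.
Proof. by rewrite !coordE; ring. Qed.

Lemma dotvv_ge0 u : 0 <= dot u u.
Proof. by apply: sumr_ge0 => j _; rewrite -expr2 sqr_ge0. Qed.

Lemma dotvv_eq0 u : (dot u u == 0) = (u == 0).
Proof.
apply/eqP/eqP => [h|->]; last by rewrite !coordE; ring.
apply/rowP => j; rewrite mxE.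
move/eqP: h; rewrite psumr_eq0 => [/allP /(_ j)|i _]; last first.
  by rewrite -expr2 sqr_ge0.
by rewrite mem_index_enum mulf_eq0 orbb => /(_ isT) /eqP.
Qed.

Lemma sqr_enorm u : enorm u ^+ 2 = dot u u.
Proof. by rewrite sqr_sqrtr ?dotvv_ge0. Qed.

Lemma enorm_gt0 {u} : u != 0 -> 0 < enorm u.
Proof. by move=> u0; rewrite sqrtr_gt0 lt0r dotvv_eq0 u0 dotvv_ge0. Qed.

Lemma dot_normalized u : u != 0 ->
  dot ((enorm u)^-1 *: u) ((enorm u)^-1 *: u) = 1.
Proof.
move=> /enorm_gt0/lt0r_neq0 u0; rewrite dotZl dotZr -sqr_enorm.
by field.
Qed.

(** * Positively oriented orthonormal frames and coordinates in them *)

Record direct_frame (T N B : 'rV[R]_3) : Prop := DirectFrame {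
  dotTT : dot T T = 1; dotNN : dot N N = 1; dotBB : dot B B = 1;
  dotTN : dot T N = 0; dotTB : dot T B = 0; dotNB : dot N B = 0;
  crossTN : cross T N = B; crossNB : cross N B = T; crossBT : cross B T = N }.

Lemma direct_frame_cross u v : dot u u = 1 -> dot v v = 1 -> dot u v = 0 ->
  direct_frame u (cross v u) v.
Proof.
move=> uu vv uv; have vu : dot v u = 0 by rewrite dotC.
have TN : cross u (cross v u) = v by rewrite cross_crossr uu uv scale1r scale0r subr0.
have NB : cross (cross v u) v = u.
  by rewrite crossC cross_crossr vv vu scale1r scale0r sub0r opprK.
split=> //.
- by rewrite dot_cross_cross uu vv vu uv; ring.
- by rewrite !coordE; ring.
- exact: dot_crossl.
Qed.

(** With [u] and [v] the first two derivatives of a curve, this triple is its Frenet frame. The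
    factor [u] is nonzero, since otherwise its cross product with [v] would vanish. *)
Lemma cross_normalized_frame u v : cross u v != 0 ->
  let T := (enorm u)^-1 *: u in
  let B := (enorm (cross u v))^-1 *: cross u v in
  direct_frame T (cross B T) B.
Proof.
move=> uv0 T B; apply: direct_frame_cross.
- apply: dot_normalized; apply: contra uv0 => /eqP ->.
  by rewrite cross0v.
- exact: dot_normalized.
- by rewrite dotZl dotZr dotC dot_crossl !mulr0.
Qed.

Section FrameCoordinates.
Variables T N B : 'rV[R]_3.
Hypothesis TNB : direct_frame T N B.

Lemma dot_frame x y z x' y' z' :
  dot (x *: T + y *: N + z *: B) (x' *: T + y' *: N + z' *: B) =
  x * x' + y * y' + z * z'.
Proof.
case: TNB => TT NN BB TN' TB' NB' _ _ _.
rewrite !(dotDl, dotDr, dotZl, dotZr) (dotC N T) (dotC B T) (dotC B N).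
by rewrite TT NN BB TN' TB' NB'; ring.
Qed.

Lemma cross_frame x y z x' y' z' :
  cross (x *: T + y *: N + z *: B) (x' *: T + y' *: N + z' *: B) =
  (y * z' - z * y') *: T + (z * x' - x * z') *: N + (x * y' - y * x') *: B.
Proof.
case: TNB => _ _ _ _ _ _ TN' NB' BT'.
rewrite !(crossDl, crossDr, crossZl, crossZr) !crossvv.
rewrite (crossC N T) (crossC T B) (crossC B N) TN' NB' BT'.
by apply: row3P; rewrite !mxE; ring.
Qed.

Lemma frame_scale a x y z :
  a *: (x *: T + y *: N + z *: B) = (a * x) *: T + (a * y) *: N + (a * z) *: B.
Proof. by rewrite !scalerDr !scalerA. Qed.

Lemma dot_frameT x y z : dot (x *: T + y *: N + z *: B) T = x.
Proof.
case: TNB => TT _ _ TN' TB' _ _ _ _.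
by rewrite !(dotDl, dotZl) (dotC N T) (dotC B T) TT TN' TB'; ring.
Qed.

Lemma dot_frameN x y z : dot (x *: T + y *: N + z *: B) N = y.
Proof.
case: TNB => _ NN _ TN' _ NB' _ _ _.
by rewrite !(dotDl, dotZl) (dotC B N) NN TN' NB'; ring.
Qed.

Lemma dot_frameB x y z : dot (x *: T + y *: N + z *: B) B = z.
Proof.
case: TNB => _ _ BB _ TB' NB' _ _ _.
by rewrite !(dotDl, dotZl) BB TB' NB'; ring.
Qed.

End FrameCoordinates.

End Vectors.

Arguments dotTT {R T N B}.
Arguments dotNN {R T N B}.
Arguments dotBB {R T N B}.
Arguments dotTN {R T N B}.
Arguments dotTB {R T N B}.
Arguments dotNB {R T N B}.
Arguments dot_frame {R T N B}.
Arguments cross_frame {R T N B}.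
Arguments dot_frameT {R T N B}.
Arguments dot_frameN {R T N B}.
Arguments dot_frameB {R T N B}.

(** * Product rules for vector-valued functions *)

Section Derivatives.
Context {R : realType}.
Implicit Types (f g : R -> 'rV[R]_3) (a b c : R -> R) (s : R) (I : set R).

Lemma is_derive_derive1 {V : normedModType R} {h : R -> V} {s} :
  derivable h s 1 -> is_derive s 1 h (derive1 h s).
Proof. by move=> hs; rewrite derive1E; exact: derivableP. Qed.

Lemma derive1_is_derive {V : normedModType R} {h : R -> V} {s dh} :
  is_derive s 1 h dh -> derive1 h s = dh.
Proof. by move=> hs; rewrite derive1E; exact: derive_val. Qed.

(** An open [I] is a neighbourhood of each of its points, so an identity known only on [I] can be
    differentiated there. *)
Lemma is_derive_eq_on {V : normedModType R} {I} {g h : R -> V} {s dh} :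
  open I -> I s -> (forall t, I t -> g t = h t) ->
  is_derive s 1 h dh -> is_derive s 1 g dh.
Proof.
move=> oI Is gh; apply: near_eq_is_derive.
by apply: filterS (open_nbhs_nbhs (conj oI Is)) => t It; rewrite gh.
Qed.

Lemma is_derive_rowP {f s df} :
  is_derive s 1 f df <-> forall j, is_derive s 1 (fun t => f t 0 j) (df 0 j).
Proof.
split=> [[/[dup] fs /derivable_mxP cs <-] j|cs].
  by rewrite derive_mx // mxE; exact: derivableP.
have fs : derivable f s 1.
  by apply/derivable_mxP => i j; rewrite (ord1 i); case: (cs j).
split=> //; rewrite derive_mx //; apply/rowP => j.
by rewrite mxE; case: (cs j).
Qed.

Lemma is_derive_mul {a b s da db} :
  is_derive s 1 a da -> is_derive s 1 b db ->
  is_derive s 1 (fun t => a t * b t) (da * b s + a s * db).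
Proof.
move=> ha hb; apply: is_derive_eq (is_deriveM ha hb) _.
by rewrite /GRing.scale /=; ring.
Qed.

Lemma is_derive_dot {f g s df dg} :
  is_derive s 1 f df -> is_derive s 1 g dg ->
  is_derive s 1 (fun t => dot (f t) (g t)) (dot df (g s) + dot (f s) dg).
Proof.
move=> /is_derive_rowP hf /is_derive_rowP hg; rewrite -big_split /=.
have h j := is_derive_mul (hf j) (hg j).
have -> : (fun t => dot (f t) (g t)) = \sum_j (fun t => f t 0 j * g t 0 j).
  by apply/funext => t; rewrite fct_sumE.
exact: is_derive_sum.
Qed.

Lemma is_derive_scale {a f s da df} :
  is_derive s 1 a da -> is_derive s 1 f df ->
  is_derive s 1 (fun t => a t *: f t) (da *: f s + a s *: df).
Proof.
move=> ha /is_derive_rowP hf; apply/is_derive_rowP => j; rewrite !mxE.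
under eq_fun do rewrite mxE.
exact: is_derive_mul.
Qed.

(** Leibniz rule for moving coordinates, with the Frenet equations substituted for the derivatives
    of the frame. *)
Lemma is_derive_frame {T N B : R -> 'rV[R]_3} {a b c s da db dc k t} :
  is_derive s 1 T (k *: N s) ->
  is_derive s 1 N (- k *: T s + t *: B s) ->
  is_derive s 1 B (- t *: N s) ->
  is_derive s 1 a da -> is_derive s 1 b db -> is_derive s 1 c dc ->
  is_derive s 1 (fun x => a x *: T x + b x *: N x + c x *: B x)
    ((da - b s * k) *: T s + (a s * k + db - c s * t) *: N s
     + (dc + b s * t) *: B s).
Proof.
move=> hT hN hB ha hb hc.
apply: is_derive_eq (is_deriveD (is_deriveD (is_derive_scale ha hT)
  (is_derive_scale hb hN)) (is_derive_scale hc hB)) _.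
by apply: row3P; rewrite !mxE; ring.
Qed.

End Derivatives.

(** * Pointwise algebra of the associated frame *)

Section Associated.
Context {R : realType}.

(** As [v] is nonzero, dependence makes [u] a multiple of [v]; comparing squared lengths determines
    the factor up to sign. *)
Lemma dependent_unit {u v : 'rV[R]_3} : dot u u = 1 -> dot v v = 1 ->
  ~~ free [:: u; v] -> exists2 c : R, c ^+ 2 = 1 & u = c *: v.
Proof.
move=> uu vv; rewrite free_cons seq1_free span_seq1 negb_and !negbK.
case/orP => [/vlineP [c uE]|].
  by exists c => //; rewrite -uu uE dotZl dotZr vv; ring.
by rewrite -dotvv_eq0 vv oner_eq0.
Qed.

(** Here [u] and [v] stand for the first two derivatives of the associated curve at one point, so
    that no differentiation is left. *)
Lemma NR_frames {T N B u v : 'rV[R]_3} {a b c x y z e f : R} :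
  direct_frame T N B ->
  u = a *: T + b *: N + c *: B -> v = x *: T + y *: N + z *: B ->
  cross u v != 0 -> (e, f) != (0, 0) ->
  let K := b * z - c * y in
  let L := c * x - a * z in
  let M := a * y - b * x in
  let r := Num.sqrt (e ^+ 2 + f ^+ 2) in
  let q := Num.sqrt (a ^+ 2 + c ^+ 2) in
  let Ts := (enorm u)^-1 *: u in
  let Bs := (enorm (cross u v))^-1 *: cross u v in
  let Rs := r^-1 *: (e *: Ts + f *: Bs) in
  ~~ free [:: N; Rs] ->
  [/\ 0 < dot N Rs -> 0 < f ->
        Ts = r^-1 *: ((a * f / q) *: T + e *: N + (c * f / q) *: B),
      b != 0 -> L != 0 ->
        cross Bs Ts = (e * f / (e ^+ 2 + f ^+ 2)) *:
          ((c / b - M / L) *: T + (K / L - a / b) *: B)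
    & 0 < dot N Rs -> L != 0 ->
        Bs = (f / r) *: ((K / L) *: T + N + (M / L) *: B)].
Proof.
move=> F uE vE uv0 ef0 K L M r q Ts Bs Rs.
have r2_gt0 : 0 < e ^+ 2 + f ^+ 2.
  rewrite lt0r addr_ge0 ?sqr_ge0 // andbT paddr_eq0 ?sqr_ge0 // !sqrf_eq0.
  by move: ef0; rewrite xpair_eqE.
have r_gt0 : 0 < r by rewrite sqrtr_gt0.
have r2 : r ^+ 2 = e ^+ 2 + f ^+ 2 by rewrite sqr_sqrtr // ltW.
have r0 := lt0r_neq0 r_gt0.
have Fs : direct_frame Ts (cross Bs Ts) Bs by exact: cross_normalized_frame.
(* The zero component along N* gives [Rs] the three-term shape that the frame lemmas expect. *)
have RsE : Rs = (r^-1 * e) *: Ts + 0 *: cross Bs Ts + (r^-1 * f) *: Bs.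
  by rewrite scale0r addr0 /Rs scalerDr !scalerA.
have RR : dot Rs Rs = 1.
  by rewrite RsE (dot_frame Fs) -(divff (lt0r_neq0 r2_gt0)) -r2; field: r2.
case/(dependent_unit (dotNN F) RR) => d d2 NE.
have u_gt0 : 0 < enorm u.
  apply: enorm_gt0; apply: contra uv0 => /eqP ->.
  by rewrite cross0v.
have uv_gt0 := enorm_gt0 uv0.
have u0 := lt0r_neq0 u_gt0; have w0 := lt0r_neq0 uv_gt0.
have cE : cross u v = K *: T + L *: N + M *: B by rewrite uE vE (cross_frame F).
have TsE : Ts = (a / enorm u) *: T + (b / enorm u) *: N + (c / enorm u) *: B.
  by rewrite /Ts {2}uE frame_scale ![_^-1 * _]mulrC.
have BsE : Bs = (K / enorm (cross u v)) *: T + (L / enorm (cross u v)) *: N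
    + (M / enorm (cross u v)) *: B.
  by rewrite /Bs {2}cE frame_scale ![_^-1 * _]mulrC.
have NTs : b / enorm u = d * (e / r).
  transitivity (dot N Ts); first by rewrite TsE dotC (dot_frameN F).
  by rewrite NE dotZl RsE (dot_frameT Fs) [r^-1 * e]mulrC.
have NBs : L / enorm (cross u v) = d * (f / r).
  transitivity (dot N Bs); first by rewrite BsE dotC (dot_frameN F).
  by rewrite NE dotZl RsE (dot_frameB Fs) [r^-1 * f]mulrC.
have NNs : dot N (cross Bs Ts) = 0.
  by rewrite NE dotZl RsE (dot_frameN Fs) mulr0.
have dNR : dot N Rs = d by rewrite NE dotZl RR mulr1.
have d1 : 0 < dot N Rs -> d = 1.
  rewrite dNR => d_gt0; move/eqP: d2; rewrite sqrf_eq1 => /orP[/eqP //|/eqP dE].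
  by move: d_gt0; rewrite dE ltr0N1.
split.
- move=> /d1 dE f_gt0; move: NTs; rewrite dE mul1r => NTs.
  have v2 : enorm u ^+ 2 = a ^+ 2 + b ^+ 2 + c ^+ 2.
    by rewrite sqr_enorm uE (dot_frame F) -!expr2.
  have bE : b = enorm u * (e / r) by rewrite -NTs; field.
  (* With [b = enorm u * (e / r)], the difference [enorm u ^+ 2 - b ^+ 2] is the square of
     [enorm u * (f / r)]; [0 < f] removes the absolute value from its root. *)
  have qE : q = enorm u * (f / r).
    have -> : q = Num.sqrt ((enorm u * (f / r)) ^+ 2).
      congr Num.sqrt.
      have -> : a ^+ 2 + c ^+ 2 = enorm u ^+ 2 - b ^+ 2 by rewrite v2; ring.
      have fr : (f / r) ^+ 2 = 1 - (e / r) ^+ 2.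
        have f2 : f ^+ 2 = r ^+ 2 - e ^+ 2 by rewrite r2; ring.
        by rewrite expr_div_n f2; field.
      by rewrite exprMn fr bE; ring.
    by rewrite sqrtr_sqr ger0_norm // !mulr_ge0 ?invr_ge0 ?ltW.
  have f0 := lt0r_neq0 f_gt0.
  rewrite TsE frame_scale NTs qE; congr (_ *: _ + _ *: _ + _ *: _).
  + by field; rewrite u0 r0 f0.
  + by rewrite mulrC.
  + by field; rewrite u0 r0 f0.
- move=> b0 L0.
  have NsE : cross Bs Ts = (enorm u * enorm (cross u v))^-1 *:
      ((L * c - M * b) *: T + (M * a - K * c) *: N + (K * b - L * a) *: B).
    rewrite /Ts /Bs crossZl crossZr scalerA -invfM; congr ((_)^-1 *: _).
      exact: mulrC.
    by rewrite {1}cE {1}uE (cross_frame F).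
  have N0 : M * a - K * c = 0.
    move: NNs; rewrite NsE dotZr dotC (dot_frameN F) => /eqP.
    by rewrite mulf_eq0 invr_eq0 mulf_eq0 (negbTE u0) (negbTE w0) => /eqP.
  rewrite NsE N0 scale0r addr0 -r2.
  (* Multiplying [NTs] by [NBs] leaves [d ^+ 2 = 1], so this holds for either sign. *)
  have -> : (enorm u * enorm (cross u v))^-1 = e * f / r ^+ 2 / (b * L).
    have -> : e * f / r ^+ 2 = (d * (e / r)) * (d * (f / r)).
      by rewrite mulrACA -expr2 d2 mul1r expr2; field.
    by rewrite -NTs -NBs; field; rewrite u0 w0 b0 L0.
  rewrite !scalerDr !scalerA.
  by congr (_ *: _ + _ *: _); field; rewrite r0 b0 L0.
- move=> /d1 dE L0; move: NBs; rewrite dE mul1r => NBs.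
  (* Replacing [f / r] by [L / enorm (cross u v)] cancels the denominators [L]. *)
  rewrite -[X in _ + X + _]scale1r BsE frame_scale -NBs.
  by congr (_ *: _ + _ *: _ + _ *: _); field; rewrite ?L0 w0.
Qed.

End Associated.

(** * Regularity of curvature and torsion of the unit-speed curve *)

Section UnitSpeed.
Context {R : realType} {I : set R} {alpha : R -> 'rV[R]_3} {kappa tau : R -> R}.
Hypotheses (oI : open I) (d4 : derivable_upto 4 I alpha)
  (unit_speed : forall s, I s -> enorm (derive1 alpha s) = 1)
  (Fr : has_frenet_frame I alpha) (FE : frenet_equations I alpha kappa tau).

Lemma frenet_direct_frame s : I s ->
  direct_frame (frenet_T alpha s) (frenet_N alpha s) (frenet_B alpha s).
Proof. by move=> /Fr; exact: cross_normalized_frame. Qed.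

Lemma derive1_frenet_T s : I s -> derive1 alpha s = frenet_T alpha s.
Proof. by move=> Is; rewrite /frenet_T unit_speed // invr1 scale1r. Qed.

Lemma derive2_curvature s : I s ->
  derive1n 2 alpha s = kappa s *: frenet_N alpha s.
Proof.
move=> Is; apply: derive1_is_derive.
by case: (FE s Is) => hT _ _; exact: is_derive_eq_on oI Is derive1_frenet_T hT.
Qed.

Lemma curvature_neq0 s : I s -> kappa s != 0.
Proof.
move=> Is; apply: contra (Fr s Is) => /eqP k0.
by rewrite derive2_curvature // k0 scale0r crossv0.
Qed.

(** The third derivative of [alpha] and the Frenet equation for N give both factors of
    [kappa = alpha'' . N] a derivative. *)
Lemma derivable_curvature s : I s -> derivable kappa s 1.
Proof.
move=> Is; have [_ hN _] := FE s Is.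
have h2 := is_derive_derive1 (d4 2 isT s Is).
have kE t : I t -> kappa t = dot (derive1n 2 alpha t) (frenet_N alpha t).
  move=> It; rewrite derive2_curvature // dotZl.
  by rewrite (dotNN (frenet_direct_frame t It)) mulr1.
by have [] := is_derive_eq_on oI Is kE (is_derive_dot h2 hN).
Qed.

(** In the derivative of [kappa N], only the term [kappa N'] has a component along B. *)
Lemma dot_derive3_binormal s : I s ->
  dot (derive1n 3 alpha s) (frenet_B alpha s) = kappa s * tau s.
Proof.
move=> Is; have [_ hN _] := FE s Is; have F := frenet_direct_frame s Is.
have hk := is_derive_derive1 (derivable_curvature s Is).
have := is_derive_eq_on oI Is derive2_curvature (is_derive_scale hk hN).
move=> /derive1_is_derive /= ->.
(* Abstracting the frame keeps [scalerA] from unfolding it to [_ *: _]. *)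
move: (frenet_T alpha s) (frenet_N alpha s) (frenet_B alpha s) F => T N B F.
by rewrite scalerDr !scalerA addrCA addrA (dot_frameB F).
Qed.

(** Dividing the previous identity by the nonzero [kappa] expresses [tau] through [alpha'''], which
    is where the fourth derivative enters. *)
Lemma derivable_torsion s : I s -> derivable tau s 1.
Proof.
move=> Is; have [_ _ hB] := FE s Is.
have h3 := is_derive_derive1 (d4 3 isT s Is).
have hk := is_derive_derive1 (derivable_curvature s Is).
have tE t : I t ->
    tau t = (kappa t)^-1 * dot (derive1n 3 alpha t) (frenet_B alpha t).
  by move=> It; rewrite dot_derive3_binormal // mulKf // curvature_neq0.
by have [] := is_derive_eq_on oI Is tE
  (is_derive_mul (is_deriveV (curvature_neq0 s Is) hk) (is_derive_dot h3 hB)).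
Qed.

(** * First two derivatives of the offset curve *)

Context {alphas : R -> 'rV[R]_3} {lambda : R -> R}.
Hypotheses (d2 : derivable_upto 2 I alphas)
  (asE : forall s, I s -> alphas s = alpha s + lambda s *: frenet_N alpha s).

Lemma derivable_offset s : I s -> derivable lambda s 1.
Proof.
move=> Is; have [_ hN _] := FE s Is.
have h1 := is_derive_derive1 (d4 0 isT s Is).
have hs := is_derive_derive1 (d2 0 isT s Is).
have lE t : I t -> lambda t = dot ((alphas - alpha) t) (frenet_N alpha t).
  move=> It; rewrite fctE asE // addrC addKr dotZl.
  by rewrite (dotNN (frenet_direct_frame t It)) mulr1.
by have [] := is_derive_eq_on oI Is lE
  (is_derive_dot (is_deriveB hs h1) hN).
Qed.

Lemma derive1_offset s : I s ->
  derive1 alphas s = (1 - lambda s * kappa s) *: frenet_T alpha s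
    + derive1 lambda s *: frenet_N alpha s
    + (lambda s * tau s) *: frenet_B alpha s.
Proof.
move=> Is; apply: derive1_is_derive.
have [_ hN _] := FE s Is.
have h1 := is_derive_derive1 (d4 0 isT s Is).
have hl := is_derive_derive1 (derivable_offset s Is).
apply: (is_derive_eq_on oI Is asE).
apply: is_derive_eq (is_deriveD h1 (is_derive_scale hl hN)) _.
rewrite /= (derive1_frenet_T s Is).
by apply: row3P; rewrite !mxE; ring.
Qed.

(** By [derive1_offset], [lambda'] is the N-coordinate of [alphas'], so the second derivative of
    [alphas] yields that of [lambda]. *)
Lemma derivable_derive1_offset s : I s -> derivable (derive1 lambda) s 1.
Proof.
move=> Is; have [_ hN _] := FE s Is.
have h2 := is_derive_derive1 (d2 1 isT s Is).
have lE t : I t -> derive1 lambda t = dot (derive1 alphas t) (frenet_N alpha t).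
  by move=> It; rewrite derive1_offset // (dot_frameN (frenet_direct_frame t It)).
by have [] := is_derive_eq_on oI Is lE (is_derive_dot h2 hN).
Qed.

(** The coordinates are arranged as the factors in [NR_coefK], [NR_coefL] and [NR_coefM], so that
    these appear as the cross product. *)
Lemma derive2_offset s : I s ->
  derive1n 2 alphas s =
    (- lambda s * derive1 kappa s - 2 * derive1 lambda s * kappa s)
      *: frenet_T alpha s
    + ((- lambda s * kappa s + 1) * kappa s - lambda s * tau s ^+ 2
       + derive1n 2 lambda s) *: frenet_N alpha s
    + (lambda s * derive1 tau s + 2 * derive1 lambda s * tau s)
      *: frenet_B alpha s.
Proof.
move=> Is; have [hT hN hB] := FE s Is.
have hk := is_derive_derive1 (derivable_curvature s Is).
have ht := is_derive_derive1 (derivable_torsion s Is).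
have hl := is_derive_derive1 (derivable_offset s Is).
have hl' := is_derive_derive1 (derivable_derive1_offset s Is).
have ha := is_deriveB (is_derive_cst (1 : R) s 1) (is_derive_mul hl hk).
apply: derive1_is_derive; apply: (is_derive_eq_on oI Is derive1_offset).
apply: is_derive_eq (is_derive_frame hT hN hB ha hl' (is_derive_mul hl ht)) _.
by congr (_ *: _ + _ *: _ + _ *: _); rewrite /= ?fctE /=; ring.
Qed.

End UnitSpeed.

(* The formulas for T* and B* are those of the orientation in which N = R* and
   not N = - R*; the one for T* moreover takes f > 0. The factor of N* is
   e f / (e^2 + f^2), the only one for which N* is a unit vector. *)
Theorem theorem4p5 (R : realType) (I : set R) (alpha alphas : R -> 'rV[R]_3)
    (kappa tau lambda : R -> R) (e f : R) :
  open I -> is_interval I ->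
  derivable_upto 4 I alpha -> derivable_upto 2 I alphas ->
  (forall s, I s -> enorm (derive1 alpha s) = 1) ->
  has_frenet_frame I alpha -> has_frenet_frame I alphas ->
  frenet_equations I alpha kappa tau ->
  (e, f) != (0, 0) ->
  (forall s, I s -> alphas s = alpha s + lambda s *: frenet_N alpha s) ->
  NR_associated I e f alpha alphas ->
  forall s, I s ->
  let T := frenet_T alpha s in
  let N := frenet_N alpha s in
  let B := frenet_B alpha s in
  let K := NR_coefK kappa tau lambda s in
  let L := NR_coefL kappa tau lambda s in
  let M := NR_coefM kappa tau lambda s in
  let l := lambda s in
  let l' := derive1 lambda s in
  let k := kappa s in
  let t := tau s in
  let r := Num.sqrt (e ^+ 2 + f ^+ 2) in
  let q := Num.sqrt ((- l * k + 1) ^+ 2 + (l * t) ^+ 2) in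
  [/\ (0 < dot N (rectifying e f alphas s) -> 0 < f ->
        frenet_T alphas s =
          r^-1 *: (((- l * k + 1) * f / q) *: T + e *: N
                   + (l * t * f / q) *: B)),
      (l' != 0 -> L != 0 ->
        frenet_N alphas s =
          (e * f / (e ^+ 2 + f ^+ 2)) *:
            ((l * t / l' - M / L) *: T + (K / L + (l * k - 1) / l') *: B))
    & (0 < dot N (rectifying e f alphas s) -> L != 0 ->
        frenet_B alphas s =
          (f / r) *: ((K / L) *: T + N + (M / L) *: B))].
Proof.
move=> oI _ d4 d2 unit_speed Fr Frs FE ef0 asE NR s Is T N B K L M l l' k t r q.
have F : direct_frame T N B by exact: frenet_direct_frame Fr s Is.
have u_eq := derive1_offset oI d4 unit_speed Fr FE d2 asE s Is.
have v_eq := derive2_offset oI d4 unit_speed Fr FE d2 asE s Is.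
have aE : 1 - lambda s * kappa s = - l * k + 1 by rewrite /l /k; ring.
rewrite {}aE in u_eq.
have [hT hN hB] := NR_frames F u_eq v_eq (Frs s Is) ef0 (NR s Is).
(* The cross-product coordinates are K, L and M: the first and last by definition, L after moving a
   sign between its factors. *)
have KE : l' * (l * derive1 tau s + 2 * l' * t) - l * t *
    ((- l * k + 1) * k - l * t ^+ 2 + derive1n 2 lambda s) = K by [].
have LE : l * t * (- l * derive1 kappa s - 2 * l' * k) - (- l * k + 1) *
    (l * derive1 tau s + 2 * l' * t) = L by rewrite /L /NR_coefL -/l -/l' -/k -/t; ring.
have ME : (- l * k + 1) * ((- l * k + 1) * k - l * t ^+ 2 + derive1n 2 lambda s)
  - l' * (- l * derive1 kappa s - 2 * l' * k) = M by [].
split=> [|l'0 L0|dNR L0]; first exact: hT.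
- have := hN l'0; rewrite -/l -/l' -/k -/t KE LE ME => /(_ L0).
  rewrite -/(frenet_N alphas s) => ->.
  by congr (_ *: (_ + (_ + _) *: _)); rewrite -mulNr; congr (_ / _); ring.
- by have := hB dNR; rewrite -/l -/l' -/k -/t KE LE ME => /(_ L0).
Qed.
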